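(* Let $X_n$ be the number of correct guesses in the card guessing game with complete feedback after a single shelf shuffle of $n$ cards. Then $$\mathbb E(X_n)=\tfrac34\, n\quad\text{for all } n\ge 2,\qquad \mathbb E(X_1)=1,$$ and the variance satisfies $$\mathbb V(X_n)=\frac{n}{16}\quad\text{for all } n\ge 3,\qquad \mathbb V(X_1)=0,\quad \mathbb V(X_2)=\tfrac14 .$$
   Context: Single shelf shuffle: an ordered deck of $n$ cards labelled $1,\dots,n$ (card $1$ on top, card $n$ at the bottom) is given. Cards are drawn one by one from the bottom of the deck (so in the order $n,n-1,\dots,1$) and put on an initially empty pile; each drawn card is placed, independently, at the top or at the bottom of the pile with probability $1/2$ each. The final pile is the shuffled deck. Game: cards are drawn one after the other from the top of the shuffled deck. Before each draw the player guesses the label of the card; afterwards the card is shown (complete feedback). The player uses the following optimal strategy: the first guess is card $1$; as long as neither card $n-1$ nor card $n$ has been shown, the next guess is the label immediately following that of the most recently shown card; once one of the cards $n-1$ or $n$ has been shown, the player guesses the remaining (not yet shown) cards in descending order. $X_n$ denotes the total number of correct guesses. *)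

(* Defs.v *)
(* MathComp / MathComp-Analysis *)
From HB Require Import structures.
From mathcomp Require Import all_boot all_order all_algebra.
From mathcomp Require Import all_classical all_reals all_analysis.
Set Implicit Arguments.
Unset Strict Implicit.
Unset Printing Implicit Defensive.
Import Order.TTheory GRing.Theory Num.Theory.

(* Decks and piles are listed from top to bottom; card labels are 1, ..., n. *)

Definition put_card (top : bool) (c : nat) (pile : seq nat) : seq nat :=
  if top then c :: pile else rcons pile c.

(* [b i] is the coin of the card labelled [i.+1] ([true] = top of the pile).
   [foldr] handles the last element of [enum 'I_n] first, so the cards are
   placed in the order n, n-1, ..., 1. *)
Definition shelf_shuffle (n : nat) (b : 'I_n -> bool) : seq nat :=
  foldr (fun (i : 'I_n) pile => put_card (b i) i.+1 pile) [::] (enum 'I_n).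

(* [shown] lists the cards seen so far, most recent first.  For n = 1 the label
   n.-1 = 0 is not a card, so that test never succeeds.  Guessing in descending
   order is guessing the largest card not yet shown. *)
Definition guess (n : nat) (shown : seq nat) : nat :=
  if (n.-1 \in shown) || (n \in shown)
  then \max_(c <- iota 1 n | c \notin shown) c
  else if shown is c :: _ then c.+1 else 1%N.

Fixpoint correct_from (n : nat) (shown deck : seq nat) : nat :=
  if deck is c :: deck' then
    ((guess n shown == c) + correct_from n (c :: shown) deck')%N
  else 0%N.

Definition correct_guesses (n : nat) (deck : seq nat) : nat :=
  correct_from n [::] deck.

Local Open Scope classical_set_scope.
Local Open Scope ereal_scope.

(* Mutual independence: the product rule for every finite subfamily. *)
Definition mutually_independent d d' (T : measurableType d)
    (T' : measurableType d') (R : realType) (P : probability T R)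
    (I : finType) (X : I -> {RV P >-> T'}) : Prop :=
  forall (J : {set I}) (A : I -> set T'), (forall i, measurable (A i)) ->
    P (\bigcap_(i in [set i | i \in J]) (X i @^-1` A i)) =
    \prod_(i in J) P (X i @^-1` A i).

Definition fair_coins d (T : measurableType d) (R : realType)
    (P : probability T R) (I : finType) (coin : I -> {RV P >-> bool}) : Prop :=
  mutually_independent coin /\
  forall i, P (coin i @^-1` [set true]) = (2^-1)%:E.

Definition num_correct d (T : measurableType d) (R : realType)
    (P : probability T R) (n : nat) (coin : 'I_n -> {RV P >-> bool}) : T -> R :=
  fun w => ((correct_guesses n (shelf_shuffle (fun i => coin i w)))%:R)%R.

(* Main.v *)
Require Import Defs.
From HB Require Import structures.
From mathcomp Require Import all_boot all_order all_algebra.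
From mathcomp Require Import all_classical all_reals all_analysis.
From mathcomp Require Import ring lra zify.
Set Implicit Arguments.
Unset Strict Implicit.
Unset Printing Implicit Defensive.
Import Order.TTheory GRing.Theory Num.Theory.

(** If b_c is the coin of card c ([true] = top), the shuffled deck consists of
    the cards c < n with b_c in ascending order, then n, then the other cards in
    descending order.  With b_0 = b_n = true, card k is guessed correctly iff
    b_k fails or b_{k-1} and b_k both hold.  In terms of the signs
    e_c = (-1)^{1 - b_c} the number of correct guesses is therefore
    3n/4 + (e_0 e_1 + e_1 e_2 + ... + e_{n-1} e_n) / 4.
    The summands are Walsh characters of the n - 1 effective coins, nontrivial
    for n >= 2 and pairwise distinct for n >= 3, so that orthogonality gives
    the mean and the variance. *)

(** * The shuffled deck and its count of correct guesses *)

Section Combinatorics.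
Local Open Scope nat_scope.

(* Card [c] carries the coin of index [c.-1].  The coin of card [n] has no
   effect on the shuffle, so the value at [n] is free; [true] at both [0] and
   [n] makes the count of correct guesses uniform in the position. *)
Definition ext_coin (n : nat) (b : 'I_n -> bool) (c : nat) : bool :=
  [forall i : 'I_n, (i.+1 == c) && (c < n) ==> b i].

Lemma ext_coin0 n (b : 'I_n -> bool) : ext_coin b 0.
Proof. by apply/forallP => i. Qed.

Lemma ext_coin_last n (b : 'I_n -> bool) : ext_coin b n.
Proof. by apply/forallP => i; rewrite ltnn andbF. Qed.

Lemma ext_coinS n (b : 'I_n -> bool) (i : 'I_n) :
  i.+1 < n -> ext_coin b i.+1 = b i.
Proof.
move=> lt_in; apply/forallP/idP => [/(_ i)|bi j]; first by rewrite eqxx lt_in.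
by apply/implyP => /andP[/eqP[/ord_inj->]].
Qed.

Lemma foldr_put_card (B : nat -> bool) (s q : seq nat) :
  foldr (fun c => put_card (B c) c) q s =
  [seq c <- s | B c] ++ q ++ rev [seq c <- s | ~~ B c].
Proof.
elim: s => [|c s IHs] /=; first by rewrite cats0.
rewrite IHs /put_card; case: (B c) => //=.
by rewrite rev_cons !rcons_cat.
Qed.

(** The first card placed, [m.+1], forms the same pile for either coin; it is the start pile for
    [foldr_put_card]. *)
Lemma shelf_shuffleE m (b : 'I_m.+1 -> bool) (B := ext_coin b) :
  shelf_shuffle b =
  [seq c <- iota 1 m | B c] ++ m.+1 :: rev [seq c <- iota 1 m | ~~ B c].
Proof.
rewrite /shelf_shuffle enum_ordSr foldr_rcons.
have -> : put_card (b ord_max) (@ord_max m).+1 [::] = [:: m.+1].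
  by rewrite /put_card; case: ifP.
rewrite -[_ :: rev _]cat1s -(foldr_put_card B).
have -> : iota 1 m = [seq (i : 'I_m).+1 | i <- enum 'I_m].
  by rewrite -[1]/(1 + 0) iotaDl -val_enum_ord -map_comp.
move: (enum 'I_m) => e; elim: e => //= i e ->.
by rewrite -(@ext_coinS _ b (widen_ord (leqnSn m) i)) //= ltnS.
Qed.

(** The head of a descending deck is the largest unseen card, which is what the player guesses once
    a stopping card is out. *)
Lemma correct_from_descending n (shown deck : seq nat) :
  (n.-1 \in shown) || (n \in shown) -> sorted gtn deck ->
  (forall c, (c \in deck) = (c \in iota 1 n) && (c \notin shown)) ->
  correct_from n shown deck = size deck.
Proof.
have gtn_trans : transitive gtn by move=> y x z /= /[swap]; exact: ltn_trans.
elim: deck shown => [//|c deck IHdeck] shown stop dec mem_deck /=.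
have le_c x : x \in c :: deck -> x <= c.
  rewrite inE => /predU1P[->//|x_deck].
  by apply: ltnW; exact: (allP (order_path_min gtn_trans dec)).
have c_deck := mem_head c deck.
have -> : guess n shown = c.
  rewrite /guess stop; apply/eqP; rewrite eqn_leq; apply/andP; split.
    apply/bigmax_leqP_seq => x x_n x_new; apply: le_c.
    by rewrite mem_deck x_n.
  by move: c_deck; rewrite mem_deck => /andP[c_n c_new]; apply: leq_bigmax_seq.
rewrite eqxx IHdeck //; first 1 last.
- exact: path_sorted dec.
- move=> x; have := mem_deck x; rewrite !inE negb_or.
  have [->|_] /= := eqVneq x c; last by [].
  rewrite andbF => _; apply/negP => c_in.
  by have /= := allP (order_path_min gtn_trans dec) _ c_in; rewrite ltnn.
- by rewrite !inE; case/orP: stop => ->; rewrite ?orbT.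
Qed.

(** The default 0 of [head] acts as a virtual card before card 1, so the first guess 1 is also a
    successor guess; [B 0] makes the case of an empty list fit. *)
Lemma head_ascending (B : nat -> bool) k : B 0 ->
  (head 0 (rev [seq c <- iota 1 k | B c]) == k) = B k.
Proof.
move=> B0; set s := rev _; apply/eqP/idP => [<-|Bk].
  rewrite /s; case Es: (rev _) => [//|c s'] /=.
  have : c \in c :: s' by rewrite mem_head.
  by rewrite -Es mem_rev mem_filter => /andP[].
rewrite /s; case: k Bk @s => [//|k] Bk _.
by rewrite -[X in iota _ X]addn1 iotaD filter_cat /= add1n Bk rev_cat /=.
Qed.

(** Induction on the number [j] of labels below [m.+1] still to be scanned. The three summands count
    hits in the ascending run, on card [m.+1], and in the descending tail. *)
Lemma correct_from_ascending (B : nat -> bool) m j k :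
  B 0 -> k + j = m ->
  let D := rev [seq c <- iota 1 m | ~~ B c] in
  correct_from m.+1 (rev [seq c <- iota 1 k | B c])
    ([seq c <- iota k.+1 j | B c] ++ m.+1 :: D) =
  \sum_(c <- iota k.+1 j) (B c.-1 && B c) + B m + size D.
Proof.
move=> B0 Ekj D.
have sorted_D : sorted gtn D.
  rewrite /D rev_sorted.
  exact: (sorted_filter ltn_trans _ (iota_ltn_sorted 1 m)).
have mem_D c : (c \in D) = [&& ~~ B c, 0 < c & c <= m].
  by rewrite /D mem_rev mem_filter mem_iota add1n ltnS.
have mem_shown i c :
    (c \in rev [seq c <- iota 1 i | B c]) = [&& B c, 0 < c & c <= i].
  by rewrite mem_rev mem_filter mem_iota add1n ltnS.
elim: j k Ekj => [|j IHj] k Ekj.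
  rewrite big_nil add0n /=; move: Ekj; rewrite addn0 => ->.
  set s := rev [seq c <- iota 1 m | B c].
  have -> : correct_from m.+1 (m.+1 :: s) D = size D.
    apply: correct_from_descending => //; first by rewrite !inE eqxx orbT.
    move=> c; rewrite mem_D mem_iota inE mem_shown negb_or add1n !ltnS.
    by case: (B c) => /=; lia.
  (* The guess for card [m.+1]: if [B m] fails, it is the successor of a card other than [m], hence
     wrong. If [B m] holds, card [m] has been shown and [m.+1] is the largest unseen card, or [m] is
     0 and the first guess 1 is right. *)
  congr (nat_of_bool _ + _); rewrite /guess /= !mem_shown ltnn !andbF orbF.
  have [Bm|nBm] /= := boolP (B m); last first.
    have := @head_ascending B m B0; rewrite -/s (negbTE nBm) => /negbT.
    by case: s => [|c s'] /=; rewrite eqSS => /negbTE.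
  case: (posnP m) => [m0|m_gt0] /=.
    by rewrite /s m0.
  rewrite leqnn -[1 :: _]/(iota 1 m.+1); apply/eqP/anti_leq/andP; split.
    apply/bigmax_leqP_seq => x; rewrite mem_iota; lia.
  apply: leq_bigmax_seq; first by rewrite mem_iota; lia.
  by rewrite mem_shown ltnn !andbF.
have Ek1 : k.+1 + j = m by rewrite -Ekj addnS.
rewrite /= big_cons /= -!addnA.
have EB : rev [seq c <- iota 1 k.+1 | B c] =
    if B k.+1 then k.+1 :: rev [seq c <- iota 1 k | B c]
    else rev [seq c <- iota 1 k | B c].
  rewrite -[X in iota _ X]addn1 iotaD filter_cat /= add1n rev_cat.
  by case: (B k.+1).
have := IHj _ Ek1; rewrite EB.
case: (B k.+1) => /= ->; last by rewrite andbF -!addnA.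
rewrite andbT -!addnA; congr (nat_of_bool _ + _).
(* All shown labels are at most [k < m], so the successor rule is still in force; it hits [k.+1]
   exactly when the last shown card is [k]. *)
rewrite -(head_ascending k B0) /guess !mem_shown /=.
have -> : (m <= k) = false by lia.
have -> : (m < k) = false by lia.
by rewrite !andbF /=; case: (rev _) => [|c s] /=; rewrite eqSS.
Qed.

Lemma correct_guesses_shelf_shuffle m (b : 'I_m.+1 -> bool) :
  correct_guesses m.+1 (shelf_shuffle b) =
  \sum_(k < m.+1)
    ((ext_coin b k && ext_coin b k.+1) + ~~ ext_coin b k.+1).
Proof.
have B0 := ext_coin0 b; have Bn := ext_coin_last b.
rewrite shelf_shuffleE; move: (ext_coin b) B0 Bn => B B0 Bn.
rewrite /correct_guesses (@correct_from_ascending B m m 0 B0 (add0n _)).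
rewrite size_rev size_filter big_ord_recr /= Bn andbT addn0.
rewrite big_split /= addnAC; congr (_ + _ + _).
  rewrite -[1]/(1 + 0) iotaDl big_map -[in LHS](subn0 m).
  by rewrite -/(index_iota 0 m) big_mkord.
rewrite -sum1_count big_mkcond -[1]/(1 + 0) iotaDl big_map -[in LHS](subn0 m).
by rewrite -/(index_iota 0 m) big_mkord; apply: eq_bigr => i _; case: (B _).
Qed.

End Combinatorics.

(** * Walsh characters and their orthogonality *)

Section Walsh.
Local Open Scope ring_scope.
Variables (R : comPzRingType) (I : finType).
Implicit Types (S : {set I}) (v : I -> bool).

Definition walsh S v : R := \prod_(i in S) (-1) ^+ (~~ v i).

Lemma walshM S1 S2 v :
  walsh S1 v * walsh S2 v = walsh ((S1 :\: S2) :|: (S2 :\: S1)) v.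
Proof.
rewrite /walsh !(big_mkcond (fun i => i \in _)) /= -big_split /=.
apply: eq_bigr => i _; rewrite !inE.
by case: (i \in S1); case: (i \in S2); case: (v i);
  rewrite /= ?expr0 ?expr1 ?mulr1 ?mul1r ?mulrNN ?mulr1.
Qed.

(** The sum factors over the coordinates, and a coordinate in [S] contributes 1 + (-1) = 0. *)
Lemma sum_walsh S :
  \sum_(v : {ffun I -> bool}) walsh S v =
  if S == finset.set0 then 2 ^+ #|I| else 0.
Proof.
pose F i (b : bool) : R := if i \in S then (-1) ^+ (~~ b) else 1.
transitivity (\sum_(v : {ffun I -> bool}) \prod_i F i (v i)).
  by apply: eq_bigr => v _; rewrite /walsh big_mkcond.
rewrite -bigA_distr_bigA /= /F; have [->|[i iS]] := set_0Vmem S.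
  rewrite eqxx -prodr_const; apply: eq_bigr => i _.
  by rewrite big_bool /= inE.
case: eqP => [S0|_]; first by rewrite S0 inE in iS.
by rewrite (bigD1 i) //= big_bool /= iS addrC addNr mul0r.
Qed.

Lemma sum_walshM S1 S2 :
  \sum_(v : {ffun I -> bool}) walsh S1 v * walsh S2 v =
  if S1 == S2 then 2 ^+ #|I| else 0.
Proof.
under eq_bigr do rewrite walshM.
rewrite sum_walsh finset.setU_eq0 !finset.setD_eq0; congr (if _ then _ else _).
by rewrite finset.eqEsubset.
Qed.

End Walsh.

(** * Expectations over fair coins as uniform averages *)

Section Expectation.
Context d (T : measurableType d) (R : realType) (P : probability T R).
Local Open Scope classical_set_scope.
Local Open Scope ereal_scope.

Variables (I : finType) (coin : I -> {RV P >-> bool}).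
Hypothesis Hcoin : fair_coins coin.

Lemma fair_coin_prob i b : P (coin i @^-1` [set b]) = (2^-1)%:E.
Proof.
case: b; first exact: Hcoin.2.
have -> : coin i @^-1` [set false] = ~` (coin i @^-1` [set true]).
  by apply/seteqP; split => w /=; case: (coin i w).
rewrite probability_setC; last exact: measurable_funPTI.
by rewrite Hcoin.2 -EFinB; congr _%:E; lra.
Qed.

Lemma fair_coins_prob (v : {ffun I -> bool}) :
  P [set w | [ffun i => coin i w] = v] = (2^-1 ^+ #|I|)%:E.
Proof.
have -> : [set w | [ffun i => coin i w] = v] =
    \bigcap_(i in [set i | i \in [set: I]%SET]) (coin i @^-1` [set v i]).
  apply/seteqP; split => w /=.
    by move=> <- i _ /=; rewrite ffunE.
  by move=> wv; apply/ffunP => i; rewrite ffunE; apply: wv; rewrite /= inE.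
rewrite Hcoin.1; last by [].
under eq_bigr do rewrite fair_coin_prob.
by rewrite prodEFin prodr_const cardsT.
Qed.

(** The level sets of the coin vector partition the space into events of equal probability, so the
    random variable is a finite combination of their indicators. *)
Lemma expectation_fair_coins (f : {ffun I -> bool} -> R) :
  'E_P[fun w => f [ffun i => coin i w]] = (2^-1 ^+ #|I| * \sum_v f v)%R%:E.
Proof.
pose E v := [set w | [ffun i => coin i w] = v].
have mE v : measurable (E v).
  have -> : E v = \bigcap_(i in setT) (coin i @^-1` [set v i]).
    apply/seteqP; split => w /=; first by move=> <- i _ /=; rewrite ffunE.
    by move=> wv; apply/ffunP => i; rewrite ffunE; apply: wv.
  by apply: fin_bigcap_measurable => // i _; exact: measurable_funPTI.
rewrite unlock; transitivity
    (\int[P]_w \sum_(v : {ffun I -> bool}) ((f v)%:E * (\1_(E v) w)%:E)).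
  apply: eq_integral => w _; rewrite (bigD1 [ffun i => coin i w]) //=.
  rewrite indicE mem_set // mule1 big1 ?adde0 // => v /eqP vw.
  by rewrite indicE memNset ?mule0 // /E /= => /esym.
rewrite integral_sum //; last first.
  by move=> v; apply: integrableZl => //; exact: integrable_indic.
rewrite mulr_sumr -sumEFin; apply: eq_bigr => v _.
rewrite integralZl //; last exact: integrable_indic.
rewrite EFinM muleC; congr (_ * _).
by rewrite integral_indic // setIT; exact: fair_coins_prob.
Qed.

End Expectation.

(** * Products of neighbouring signs around a cycle *)

Section CyclicProducts.
Local Open Scope ring_scope.

(** Indices of the coins entering e_k e_{k+1}; coin [i] belongs to card [i.+1]. Positions 0 and [n]
    have constant sign 1 and are dropped, so these are the edges of an [n]-cycle with one vertex
    deleted. *)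
Definition cyc_pair n (k : 'I_n) : {set 'I_n} :=
  [set i : 'I_n | (i.+1 == k) || ((i == k) && (k.+1 < n)%N)].

Lemma walsh_cyc_pair (R : comPzRingType) n (b : 'I_n -> bool) (k : 'I_n) :
  walsh R (cyc_pair k) b =
  (-1) ^+ (~~ ext_coin b k) * (-1) ^+ (~~ ext_coin b k.+1).
Proof.
have signE c : (-1) ^+ (~~ ext_coin b c) =
    \prod_(i : 'I_n | (i.+1 == c) && (c < n)%N) ((-1) ^+ (~~ b i) : R).
  have [lt_cn|ge_cn] := ltnP c n; last first.
    rewrite big_pred0 => [|i]; last by rewrite andbF.
    suff -> : ext_coin b c by [].
    by apply/forallP => i; rewrite ltnNge ge_cn andbF.
  case: c lt_cn => [|c] lt_cn; first by rewrite ext_coin0 big_pred0.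
  rewrite (big_pred1 (Ordinal (ltnW lt_cn))).
    by rewrite -(@ext_coinS _ _ (Ordinal (ltnW lt_cn))).
  by move=> i; rewrite andbT eqSS.
rewrite !signE /walsh !(big_mkcond (fun i => _ && _)).
rewrite (big_mkcond (fun i => i \in _)).
rewrite -big_split /=; apply: eq_bigr => i _.
rewrite inE eqSS ltn_ord andbT -(inj_eq val_inj) /=.
have [ik|] := eqVneq i.+1 k; last by rewrite mul1r.
by rewrite ltn_eqF ?mulr1 // -ik.
Qed.

Lemma cyc_pair_neq0 n (k : 'I_n) : (1 < n)%N -> cyc_pair k != finset.set0.
Proof.
move=> n_gt1; apply/finset.set0Pn; have k_n := ltn_ord k.
have [k0|k_gt0] := posnP k.
  by exists k; rewrite inE eqxx k0 n_gt1 orbT.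
have lt_k : (k.-1 < n)%N by lia.
by exists (Ordinal lt_k); rewrite inE /= prednK // eqxx.
Qed.

Lemma cyc_pair_inj n : (2 < n)%N -> injective (@cyc_pair n).
Proof.
move=> n_gt2 k k' /setP eq_kk'; apply: val_inj => /=.
have mem i (lt_in : (i < n)%N) :
    (i.+1 == k) || ((i == k) && (k.+1 < n)%N) =
    (i.+1 == k') || ((i == k') && (k'.+1 < n)%N).
  by have := eq_kk' (Ordinal lt_in); rewrite !inE -!(inj_eq val_inj).
have k_n := ltn_ord k; have k'_n := ltn_ord k'.
(* Every element of the two sets is among [k], [k'] and their predecessors, so these four membership
   tests decide equality. *)
have := mem k k_n; have := mem k' k'_n.
have := mem k.-1 (leq_ltn_trans (leq_pred _) k_n).
have := mem k'.-1 (leq_ltn_trans (leq_pred _) k'_n).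
move: (nat_of_ord k) (nat_of_ord k') k_n k'_n => {mem eq_kk' k k'} k k'; lia.
Qed.

Lemma correct_guesses_walsh (R : realFieldType) n (b : 'I_n -> bool) :
  (0 < n)%N ->
  (correct_guesses n (shelf_shuffle b))%:R =
  3 / 4 * n%:R + 4^-1 * \sum_(k < n) walsh R (cyc_pair k) b.
Proof.
case: n b => [//|m] b _; rewrite correct_guesses_shelf_shuffle natr_sum.
under [in RHS]eq_bigr do rewrite walsh_cyc_pair.
pose e c : R := (-1) ^+ (~~ ext_coin b c).
(* Each summand is an affine function of e_k, e_{k+1} and their product; its linear part telescopes
   to zero because e_0 = e_n = 1. *)
transitivity (\sum_(k < m.+1)
    (3 / 4 + 4^-1 * (e k * e k.+1) - 4^-1 * (e k.+1 - e k))).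
  apply: eq_bigr => k _; rewrite /e.
  by case: (ext_coin b k); case: (ext_coin b k.+1);
    rewrite /= ?expr0 ?expr1; lra.
rewrite sumrB big_split /= sumr_const card_ord -(mulr_natr (3 / 4)) -!mulr_sumr.
rewrite -(big_mkord xpredT (fun k => e k.+1 - e k)) telescope_sumr //.
by rewrite /e ext_coin0 ext_coin_last subrr mulr0 subr0.
Qed.

End CyclicProducts.

(** * Mean and variance of the number of correct guesses *)

Section NumCorrect.
Context d (T : measurableType d) (R : realType) (P : probability T R).
Variables (n : nat) (coin : 'I_n -> {RV P >-> bool}).
Hypothesis Hcoin : fair_coins coin.
Local Open Scope ring_scope.
Local Open Scope ereal_scope.

Lemma num_correct_walsh : (0 < n)%N ->
  num_correct coin = fun w => (3 / 4 * n%:R +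
    4^-1 * \sum_(k < n) walsh R (cyc_pair k) [ffun i => coin i w])%R.
Proof.
move=> n_gt0; apply/funext => w; rewrite /num_correct correct_guesses_walsh //.
congr (_ + _ * _)%R; apply: eq_bigr => k _.
by apply: eq_bigr => i _; rewrite ffunE.
Qed.

Lemma expectation_num_correct : (1 < n)%N ->
  'E_P[num_correct coin] = (3 / 4 * n%:R)%R%:E.
Proof.
move=> n_gt1; rewrite num_correct_walsh ?(ltnW n_gt1) //.
rewrite (expectation_fair_coins Hcoin (fun v => 3 / 4 * n%:R +
  4^-1 * \sum_(k < n) walsh R (cyc_pair k) v)%R).
rewrite big_split /= -[X in (_ + X)%R]mulr_sumr exchange_big /=.
rewrite [X in (_ + 4^-1 * X)%R]big1.
  rewrite mulr0 addr0 sumr_const card_ffun card_bool card_ord.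
  rewrite -(mulr_natr (_ * n%:R)) natrX mulrCA exprVn.
  by rewrite mulVf ?mulr1 // expf_neq0.
by move=> k _; rewrite sum_walsh (negbTE (cyc_pair_neq0 _ n_gt1)).
Qed.

(** Expanding the squared deviation, orthogonality leaves the pairs of equal characters. Keeping
    them as a count covers [n = 2], where distinct indices give the same set. *)
Lemma variance_num_correct : (1 < n)%N ->
  'V_P[num_correct coin] =
  (16^-1 * \sum_(k < n) \sum_(l < n) (cyc_pair k == cyc_pair l)%:R)%R%:E.
Proof.
move=> n_gt1; rewrite /variance unlock expectation_num_correct //=.
rewrite num_correct_walsh ?(ltnW n_gt1) //.
pose f (v : {ffun 'I_n -> bool}) : R :=
  (16^-1 * \sum_(k < n) \sum_(l < n)
    (walsh R (cyc_pair k) v * walsh R (cyc_pair l) v))%R.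
transitivity ('E_P[fun w => f [ffun i => coin i w]]).
  congr ('E_P[_]); apply/funext => w; rewrite /f !fctE /=.
  under [in RHS]eq_bigr do rewrite -mulr_sumr.
  by rewrite -mulr_suml; field.
rewrite (expectation_fair_coins Hcoin) -mulr_sumr exchange_big /= mulrCA.
congr (_ * _)%R%:E; rewrite mulr_sumr; apply: eq_bigr => k _.
rewrite exchange_big mulr_sumr; apply: eq_bigr => l _ /=.
rewrite sum_walshM card_ord; case: eqP => _; last by rewrite mulr0.
by rewrite exprVn mulVf // expf_neq0.
Qed.

End NumCorrect.

Local Open Scope ring_scope.
Local Open Scope ereal_scope.

Theorem theorem4 (R : realType) (d : measure_display) (T : measurableType d)
    (P : probability T R) (n : nat) (coin : 'I_n -> {RV P >-> bool})
    (Hcoin : fair_coins coin) :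
  ((2 <= n)%N -> 'E_P[num_correct coin] = (3 / 4 * n%:R)%R%:E) /\
  (n = 1%N -> 'E_P[num_correct coin] = 1) /\
  ((3 <= n)%N -> 'V_P[num_correct coin] = (n%:R / 16)%R%:E) /\
  (n = 1%N -> 'V_P[num_correct coin] = 0) /\
  (n = 2%N -> 'V_P[num_correct coin] = (1 / 4)%R%:E).
Proof.
have num_correct1 : n = 1%N -> num_correct coin = cst 1%R.
  move=> n1; subst n; rewrite num_correct_walsh //; apply/funext => w.
  (* The only character is the empty product, so the count is 3/4 + 1/4. *)
  rewrite big_ord1 /walsh big_pred0 => [|i]; first by rewrite /=; field.
  by rewrite inE ltnn andbF orbF (ord1 i).
split; first exact: expectation_num_correct.
split; first by move=> /num_correct1->; exact: expectation_cst.
split; last split; last 1 first.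
- move=> n2; subst n; rewrite variance_num_correct //; congr _%:E.
  (* Both sets consist of the coin of card 1 alone, so all four pairs count and the variance is
     4/16. *)
  have cyc_pair_const k l : @cyc_pair 2 k = cyc_pair l.
    apply/setP => i; rewrite !inE -!(inj_eq val_inj) /=.
    by case: i k l => [[|[]]//= ?] [[|[]]//= ?] [[|[]]//= ?].
  under eq_bigr => k _ do
    under eq_bigr => l _ do rewrite (cyc_pair_const k l) eqxx.
  by rewrite !sumr_const card_ord /=; field.
- move=> n_gt2; rewrite variance_num_correct ?(ltnW n_gt2) //; congr _%:E.
  rewrite mulrC; congr (_ / _)%R.
  under eq_bigr => k _.
    rewrite (bigD1 k) //= eqxx big1 ?addr0; last first.
      by move=> l /negbTE lk; rewrite (inj_eq (cyc_pair_inj n_gt2)) eq_sym lk.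
    over.
  by rewrite sumr_const card_ord.
- by move=> /num_correct1->; exact: variance_cst.
Qed.
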